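(* The set of two-qubit density matrices $$\mathcal{S}=\{\rho_{AB}:\ I_2(\rho_{AB})\le\sqrt2\}$$ is convex and compact.
   Context: Here $\rho_{AB}$ ranges over density matrices on $\mathbb{C}^2\otimes\mathbb{C}^2$ (Alice's qubit first, Bob's second), with the usual topology of the finite-dimensional space of $4\times4$ complex matrices. For a density matrix $\rho$ on $\mathbb{C}^2$ and an orthonormal basis $\{|e_0\rangle,|e_1\rangle\}$, let $\rho_e=(\langle e_i|\rho|e_j\rangle)_{i,j}$. The robustness of imaginarity of $\rho$ in that basis is $\frac12\|\rho_e-\rho_e^T\|_1$, where $T$ is the transpose and $\|V\|_1=\operatorname{Tr}\sqrt{V^\dagger V}$. $\mathscr{I}_R^x$ denotes this quantity in the $x$-basis $\{(|0\rangle+|1\rangle)/\sqrt2,(|0\rangle-|1\rangle)/\sqrt2\}$, and $\mathscr{I}_R^y$ denotes it in the $y$-basis $\{(|0\rangle+i|1\rangle)/\sqrt2,(|0\rangle-i|1\rangle)/\sqrt2\}$. For $A\in\{x,y\}$ and $a=\pm$, let $\Pi_{\pm|A}=\frac12(\mathbb{1}_2\pm\sigma_A)$ with $\sigma_x,\sigma_y$ the Pauli matrices, $p(a|A)=\operatorname{Tr}[(\Pi_{a|A}\otimes\mathbb{1}_2)\rho_{AB}]$, and $\rho_{a|A}=\operatorname{Tr}_A[(\Pi_{a|A}\otimes\mathbb{1}_2)\rho_{AB}]/p(a|A)$. Define $$I_2(\rho_{AB})=\sum_{a=\pm}p(a|y)\,\mathscr{I}_R^x(\rho_{a|y})+\sum_{a=\pm}p(a|x)\,\mathscr{I}_R^y(\rho_{a|x}),$$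 with terms having $p(a|A)=0$ taken to be $0$. Equivalently, with $n_i=\operatorname{Tr}[(\mathbb{1}_2\otimes\sigma_i)\rho_{AB}]$ and $t_{ii}=\operatorname{Tr}[(\sigma_i\otimes\sigma_i)\rho_{AB}]$ ($\sigma_1=\sigma_x,\sigma_2=\sigma_y$), $I_2(\rho_{AB})=\frac12(|n_1-t_{11}|+|n_1+t_{11}|+|n_2-t_{22}|+|n_2+t_{22}|)$. *)

(* Defs.v *)
From HB Require Import structures.
From mathcomp Require Import all_boot all_order all_algebra.
From mathcomp Require Import complex mxtens.
From mathcomp Require Import all_classical all_reals all_analysis.

Set Implicit Arguments.
Unset Strict Implicit.
Unset Printing Implicit Defensive.

Import Order.TTheory GRing.Theory Num.Theory.
Import numFieldNormedType.Exports.

Local Open Scope classical_set_scope.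
Local Open Scope ring_scope.
Local Open Scope sesquilinear_scope.

(* The definitions are generic in [C : numClosedFieldType].  On such a field
   [x <= y] says that [y - x] is a nonnegative real, so that real quantities are
   compared directly in [C].  Vectors of C^n are columns. *)

(* For [A] normal, A = P^-1 diag(d) P with P unitary; [sqrtC] is the
   nonnegative square root on the nonnegative reals, so for [A] positive
   semidefinite this is its positive semidefinite square root. *)
Definition mxsqrt (C : numClosedFieldType) n (A : 'M[C]_n) : 'M[C]_n :=
  invmx (spectralmx A) *m diag_mx (map_mx sqrtC (spectral_diag A))
    *m spectralmx A.

Definition trace_norm (C : numClosedFieldType) n (V : 'M[C]_n) : C :=
  \tr (mxsqrt (V^t* *m V)).

Definition density_matrix (C : numClosedFieldType) n (rho : 'M[C]_n) : Prop :=
  [/\ rho \is hermsymmx,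
      forall v : 'cV[C]_n, 0 <= (v^t* *m rho *m v) 0 0
    & \tr rho = 1].

Definition mx_in_basis (C : numClosedFieldType) n (e : 'I_n -> 'cV[C]_n)
    (rho : 'M[C]_n) : 'M[C]_n :=
  \matrix_(i, j) ((e i)^t* *m rho *m e j) 0 0.

Definition robustness_imaginarity (C : numClosedFieldType) n
    (e : 'I_n -> 'cV[C]_n) (rho : 'M[C]_n) : C :=
  2^-1 * trace_norm (mx_in_basis e rho - (mx_in_basis e rho)^T).

Definition ket (C : numClosedFieldType) (i : 'I_2) : 'cV[C]_2 := delta_mx i 0.

Definition xbasis (C : numClosedFieldType) (i : 'I_2) : 'cV[C]_2 :=
  (sqrtC 2)^-1 *: (ket C 0 + (-1) ^+ i *: ket C 1).

Definition ybasis (C : numClosedFieldType) (i : 'I_2) : 'cV[C]_2 :=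
  (sqrtC 2)^-1 *: (ket C 0 + ((-1) ^+ i * 'i) *: ket C 1).

Definition sigma_x (C : numClosedFieldType) : 'M[C]_2 :=
  delta_mx 0 1 + delta_mx 1 0.

Definition sigma_y (C : numClosedFieldType) : 'M[C]_2 :=
  - 'i *: delta_mx 0 1 + 'i *: delta_mx 1 0.

(* The outcome + is [false] and the outcome - is [true]. *)
Definition outcome_proj (C : numClosedFieldType) (s : 'M[C]_2) (a : bool) :
    'M[C]_2 :=
  2^-1 *: (1%:M + (-1) ^+ a *: s).

(* [mxtens_index (i, k)] is the index of the product basis vector
   |i> (x) |k> of C^m (x) C^n. *)
Definition ptrace1 (C : numClosedFieldType) m n (M : 'M[C]_(m * n)) : 'M[C]_n :=
  \matrix_(k, l) \sum_(i < m) M (mxtens_index (i, k)) (mxtens_index (i, l)).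

Definition outcome_prob (C : numClosedFieldType) (s : 'M[C]_2) (a : bool)
    (rho : 'M[C]_(2 * 2)) : C :=
  \tr ((outcome_proj s a *t 1%:M) *m rho).

(* Division by zero yields zero: this is the zero matrix when the outcome has
   probability 0. *)
Definition conditional_state (C : numClosedFieldType) (s : 'M[C]_2) (a : bool)
    (rho : 'M[C]_(2 * 2)) : 'M[C]_2 :=
  (outcome_prob s a rho)^-1 *: ptrace1 ((outcome_proj s a *t 1%:M) *m rho).

(* A summand whose outcome has probability 0 is 0 thanks to its first factor. *)
Definition I2 (C : numClosedFieldType) (rho : 'M[C]_(2 * 2)) : C :=
  \sum_(a : bool) outcome_prob (sigma_y C) a rho *
    robustness_imaginarity (@xbasis C) (conditional_state (sigma_y C) a rho)
  + \sum_(a : bool) outcome_prob (sigma_x C) a rho *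
    robustness_imaginarity (@ybasis C) (conditional_state (sigma_x C) a rho).

Definition I2_sublevel (C : numClosedFieldType) : set 'M[C]_(2 * 2) :=
  [set rho | density_matrix rho /\ I2 rho <= sqrtC 2].

(* Naming the structure makes the topology that every numClosedFieldType
   derives from its norm, here the usual one, available on R[i]. *)
Definition complex_numbers (R : realType) : numClosedFieldType := R[i].

(* Main.v *)
Require Import Defs.
From mathcomp Require Import all_boot all_order all_algebra.
From mathcomp Require Import complex mxtens ring.
From mathcomp Require Import all_classical all_reals all_analysis.
Import numFieldNormedType.Exports.

(* For a 2 x 2 matrix V = [[0, z], [-z, 0]] one has V^* V = |z|^2 1, so the
   robustness of imaginarity is |<e_0|rho|e_1> - <e_1|rho|e_0>|.  Multiplying by
   the outcome probability turns the conditional state into the unnormalized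
   one, which is linear in rho; hence on density matrices I_2 is a sum of moduli
   of linear functionals.  The set is thus cut out by closed convex conditions,
   and it is bounded because the entries of a positive semidefinite matrix are
   bounded by twice its trace. *)

Set Implicit Arguments.
Unset Strict Implicit.
Unset Printing Implicit Defensive.

Import Order.TTheory GRing.Theory Num.Theory.

Local Open Scope classical_set_scope.
Local Open Scope ring_scope.
Local Open Scope sesquilinear_scope.

(** * Scalar-valued linear maps *)

Lemma scalar_eq0 (K : pzRingType) (V : lmodType K) (f : V -> K) :
  scalar f -> f 0 = 0.
Proof.
by move=> /(_ 1 0 0); rewrite scaler0 addr0 mul1r -[LHS]addr0 => /addrI.
Qed.

Lemma scalar_comb (K : pzRingType) (V : lmodType K) (f : V -> K) a b x y :
  scalar f -> f (a *: x + b *: y) = a * f x + b * f y.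
Proof.
by move=> f_lin; rewrite f_lin -[b *: y]addr0 f_lin scalar_eq0 // addr0.
Qed.

Section I2.
Variable C : numClosedFieldType.

(** * Sesquilinear forms and entries of positive semidefinite matrices *)

Definition sesqform n (M : 'M[C]_n) (u v : 'cV[C]_n) : C :=
  (u^t* *m M *m v) 0 0.

Lemma sesqformE n (M : 'M[C]_n) u v :
  sesqform M u v = \sum_i \sum_j (u i 0)^* * M i j * v j 0.
Proof.
rewrite /sesqform mxE exchange_big /=; apply: eq_bigr => j _.
rewrite mxE mulr_suml; apply: eq_bigr => i _.
by rewrite !mxE.
Qed.

Lemma sesqform_delta n (M : 'M[C]_n) i j :
  sesqform M (delta_mx i 0) (delta_mx j 0) = M i j.
Proof.
rewrite sesqformE (bigD1 i) //= (bigD1 j) //= !mxE !eqxx /= conjC1 mul1r mulr1.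
rewrite !big1 ?addr0 // => [k ki|k kj].
  by rewrite big1 // => l _; rewrite mxE (negPf ki) conjC0 !mul0r.
by rewrite [X in _ * X]mxE (negPf kj) mulr0.
Qed.

Lemma sesqform_linear n (M : 'M[C]_n) u : scalar (sesqform M u).
Proof. by move=> c v w; rewrite /sesqform mulmxDr -scalemxAr !mxE. Qed.

Lemma sesqform_antilinear n (M : 'M[C]_n) u c v w :
  sesqform M (c *: v + w) u = c^* * sesqform M v u + sesqform M w u.
Proof.
rewrite !sesqformE mulr_sumr -big_split; apply: eq_bigr => i _ /=.
rewrite mulr_sumr -big_split; apply: eq_bigr => j _ /=.
by rewrite !mxE rmorphD rmorphM; ring.
Qed.

Lemma sesqform_pair n (M : 'M[C]_n) i j c :
  let v := c *: delta_mx j 0 + delta_mx i 0 in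
  sesqform M v v = M i i + c * M i j + c^* * M j i + c * c^* * M j j.
Proof.
rewrite /= sesqform_antilinear !sesqform_linear !sesqform_delta; ring.
Qed.

Definition psdmx n (M : 'M[C]_n) := forall v, 0 <= sesqform M v v.

Lemma psdmx_diag_ge0 n (M : 'M[C]_n) i : psdmx M -> 0 <= M i i.
Proof. by move=> /(_ (delta_mx i 0)); rewrite sesqform_delta. Qed.

Lemma psdmx_diag_le_trace n (M : 'M[C]_n) i : psdmx M -> M i i <= \tr M.
Proof.
move=> M_ge0; rewrite /mxtrace (bigD1 i) //= lerDl sumr_ge0 // => j _.
exact: psdmx_diag_ge0.
Qed.

(** The form at [c e_j + e_i] and its two diagonal terms are real, and the cross terms are their
    difference. *)
Lemma psdmx_cross_real n (M : 'M[C]_n) i j c :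
  psdmx M -> c * M i j + c^* * M j i \is Num.real.
Proof.
move=> M_ge0; have := ger0_real (M_ge0 (c *: delta_mx j 0 + delta_mx i 0)).
rewrite sesqform_pair => h.
have -> : c * M i j + c^* * M j i =
  (M i i + c * M i j + c^* * M j i + c * c^* * M j j)
   - (M i i + c * c^* * M j j) by ring.
apply: rpredB => //; apply: ger0_real; apply: addr_ge0.
  exact: psdmx_diag_ge0.
by apply: mulr_ge0; [exact: mul_conjC_ge0|exact: psdmx_diag_ge0].
Qed.

(* Polarization with c = 1 and c = 'i in [psdmx_cross_real]. *)
Lemma psdmx_hermitian n (M : 'M[C]_n) : psdmx M -> M \is hermsymmx.
Proof.
move=> M_ge0; apply/is_hermitianmxP; rewrite expr0 scale1r.
apply/matrixP => i j; rewrite !mxE.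
have /CrealP := psdmx_cross_real i j 1 M_ge0.
have /CrealP := psdmx_cross_real i j 'i M_ge0.
rewrite !rmorphD !rmorphM /= !conjCK conjC1 conjCi !mul1r !mulNr.
rewrite -!mulrBr -!mulNr => h2 h1.
have {}h2 : (M i j)^* - (M j i)^* = M j i - M i j.
  apply: (mulfI (neq0Ci C)).
  by rewrite -[RHS]opprK -mulrN opprB mulrBr -h2; ring.
apply: (@mulfI _ 2); first by rewrite pnatr_eq0.
transitivity (((M i j)^* + (M j i)^*) - ((M i j)^* - (M j i)^*)); last by ring.
by rewrite h1 h2; ring.
Qed.

(** Positivity of the form at [c e_j + e_i] bounds the cross terms from below, and at
    [- c e_j + e_i] from above. *)
Lemma psdmx_cross_le n (M : 'M[C]_n) i j c :
  psdmx M -> c * c^* = 1 -> `|c * M i j + c^* * M j i| <= M i i + M j j.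
Proof.
move=> M_ge0 c1; rewrite real_ler_norml ?psdmx_cross_real //.
have hp := M_ge0 (c *: delta_mx j 0 + delta_mx i 0).
have hn := M_ge0 (- c *: delta_mx j 0 + delta_mx i 0).
rewrite !sesqform_pair c1 mul1r in hp; rewrite !sesqform_pair in hn.
rewrite rmorphN mulrNN c1 mul1r in hn.
apply/andP; split; rewrite -subr_ge0.
  by rewrite (_ : _ - _ = M i i + c * M i j + c^* * M j i + M j j) //; ring.
rewrite (_ : _ - _ = M i i + - c * M i j + - c^* * M j i + M j j) //; ring.
Qed.

(** The cross terms for [c = 1] and [c = 'i] are each at most [M i i + M j j] in modulus, and
    together they recover [2 * M i j]. Bounding each diagonal entry separately by the trace covers
    [i = j] as well. *)
Lemma psdmx_entry_le n (M : 'M[C]_n) i j :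
  psdmx M -> `|M i j| <= 2 * \tr M.
Proof.
move=> M_ge0.
have hd : M i i + M j j <= 2 * \tr M.
  by rewrite mulr_natl mulr2n lerD // psdmx_diag_le_trace.
have h1 : `|1 * M i j + 1^* * M j i| <= 2 * \tr M.
  by apply: le_trans hd; apply: psdmx_cross_le; rewrite // conjC1 mulr1.
have h2 : `|'i * M i j + 'i^* * M j i| <= 2 * \tr M.
  apply: le_trans hd; apply: psdmx_cross_le; rewrite // conjCi mulrN.
  by rewrite -expr2 sqrCi opprK.
rewrite -(ler_pM2l (ltr0n _ 2)) -[X in X * `|_|]normr_nat -normrM.
have -> : 2 * M i j = (1 * M i j + 1^* * M j i)
    - 'i * ('i * M i j + 'i^* * M j i).
  by rewrite conjCi conjC1; ring: (sqrCi C).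
apply: le_trans (ler_normB _ _) _.
rewrite mulr_natl mulr2n; apply: lerD => //.
by rewrite normrM normCi mul1r.
Qed.

Lemma density_matrixP n (M : 'M[C]_n) :
  density_matrix M <-> psdmx M /\ \tr M = 1.
Proof.
split=> [[_ ? ?] // | [? ?]]; split=> //; exact: psdmx_hermitian.
Qed.

(** * Trace norm of an antisymmetric 2 x 2 matrix *)

Lemma mxsqrt_scalar n (a : C) : mxsqrt (a%:M : 'M[C]_n) = (sqrtC a)%:M.
Proof.
have /orthomx_spectralP : (a%:M : 'M[C]_n) \is normalmx.
  by apply/normalmxP; rewrite tr_scalar_mx map_scalar_mx scalar_mxC.
rewrite /mxsqrt; set P := spectralmx _; set d := spectral_diag _ => aE.
have P_unit : P \in unitmx by exact: spectral_unit.
(* Scalar matrices are central, so undoing the change of basis [P] leaves [a] itself: every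
   eigenvalue listed in [d] equals [a]. *)
have dE : diag_mx d = a%:M.
  have := congr1 (fun X => P *m X *m invmx P) aE.
  by rewrite !mulmxA mulmxV // mul1mx mulmxK // scalar_mxC mulmxK.
have -> : map_mx sqrtC d = const_mx (sqrtC a).
  apply/rowP => i; rewrite !mxE.
  by have /matrixP/(_ i i) := dE; rewrite !mxE eqxx !mulr1n => ->.
by rewrite diag_const_mx scalar_mxC -mulmxA mulVmx // mulmx1.
Qed.

(** The (0, 1) entry of the antisymmetric part (without the factor 1/2) of [M] in the basis [e].
    Before the modulus is taken it is linear in [M]. *)
Definition imag_coord (e : 'I_2 -> 'cV[C]_2) (M : 'M[C]_2) : C :=
  sesqform M (e 0) (e 1) - sesqform M (e 1) (e 0).

Lemma ord2P (i : 'I_2) : i = 0 \/ i = 1.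
Proof. by case: i => [[|[|//]] ?]; [left|right]; apply: val_inj. Qed.

Lemma robustness_imaginarityE e (M : 'M[C]_2) :
  robustness_imaginarity e M = `|imag_coord e M|.
Proof.
rewrite /robustness_imaginarity; set V := _ - _.
set z := imag_coord e M.
have VE i j : V i j = sesqform M (e i) (e j) - sesqform M (e j) (e i).
  by rewrite /sesqform !mxE.
have V00 : V 0 0 = 0 by rewrite VE subrr.
have V11 : V 1 1 = 0 by rewrite VE subrr.
have V01 : V 0 1 = z by rewrite VE.
have V10 : V 1 0 = - z by rewrite VE opprB.
have -> : trace_norm V = `|z| *+ 2.
  rewrite /trace_norm (_ : V^t* *m V = (`|z| ^+ 2)%:M).
    by rewrite mxsqrt_scalar sqrCK // mxtrace_scalar.
  have ord1E : lift ord0 ord0 = 1 :> 'I_2 by exact: val_inj.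
  clearbody V; apply/matrixP => i j; rewrite !mxE big_ord_recl big_ord1 !mxE.
  rewrite ord1E normCK -[ord0]/(0 : 'I_2).
  by case: (ord2P i) => ->; case: (ord2P j) => ->;
    rewrite ?V00 ?V01 ?V10 ?V11 ?rmorphN ?conjC0 /= ?mulr1n ?mulr0n; ring.
by rewrite -[`|z| *+ 2]mulr_natl mulrA mulVf ?mul1r // pnatr_eq0.
Qed.

(** * Partial trace and unnormalized conditional states *)

Lemma sum_mxtens_index (V : nmodType) m n (F : 'I_(m * n) -> V) :
  \sum_k F k = \sum_(i < m) \sum_(j < n) F (mxtens_index (i, j)).
Proof.
rewrite pair_big /= (reindex (@mxtens_index m n)) /=.
  by apply: eq_bigr => -[].
by exists (@mxtens_unindex m n) => k _; rewrite ?mxtens_indexK ?mxtens_unindexK.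
Qed.

Lemma mxtrace_ptrace1 m n (A : 'M[C]_(m * n)) : \tr (ptrace1 A) = \tr A.
Proof.
rewrite /mxtrace sum_mxtens_index exchange_big /=.
by apply: eq_bigr => i _; rewrite mxE.
Qed.

Lemma ptrace1_rank1E m n (w : 'cV[C]_m) (rho : 'M[C]_(m * n)) k l :
  ptrace1 (((w *m w^t*) *t 1%:M) *m rho) k l =
  \sum_i \sum_j (w i 0)^* * rho (mxtens_index (i, k)) (mxtens_index (j, l))
    * w j 0.
Proof.
rewrite mxE exchange_big /=; apply: eq_bigr => j _.
rewrite mxE sum_mxtens_index; apply: eq_bigr => i _.
rewrite (bigD1 k) //= big1 ?addr0 => [|k' k'k].
  by rewrite tensmxE !mxE big_ord1 !mxE eqxx mulr1n; ring.
by rewrite tensmxE [1%:M _ _]mxE eq_sym (negPf k'k) mulr0n mulr0 mul0r.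
Qed.

(** The tensor product of two columns has [1 * 1] columns, so its column [0] agrees with the paired
    index only after [val_inj]. *)
Lemma tens_colE m n (w : 'cV[C]_m) (v : 'cV[C]_n) i j :
  (w *t v) (mxtens_index (i, j)) 0 = w i 0 * v j 0.
Proof. by rewrite -tensmxE; congr (_ _ _); exact: val_inj. Qed.

(** Both sides are the same fourfold sum over two indices of each factor, in different orders.
    Taking [u = v] transfers positivity from [rho] to the unnormalized conditional state. *)
Lemma sesqform_ptrace1 m n (w : 'cV[C]_m) (rho : 'M[C]_(m * n))
    (u v : 'cV[C]_n) :
  sesqform (ptrace1 (((w *m w^t*) *t 1%:M) *m rho)) u v =
  sesqform rho (w *t u) (w *t v).
Proof.
rewrite !sesqformE sum_mxtens_index exchange_big [RHS]exchange_big /=.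
rewrite exchange_big; apply: eq_bigr => k _.
under eq_bigr do rewrite ptrace1_rank1E mulr_sumr mulr_suml.
rewrite exchange_big; apply: eq_bigr => i _ /=.
under eq_bigr do rewrite mulr_sumr mulr_suml.
rewrite exchange_big sum_mxtens_index; apply: eq_bigr => j _ /=.
by apply: eq_bigr => l _; rewrite !tens_colE rmorphM /=; ring.
Qed.

Lemma invr_sqrtC2_normsq : (sqrtC 2)^-1 * ((sqrtC 2)^-1)^* = 2^-1 :> C.
Proof.
by rewrite geC0_conj ?invr_ge0 ?sqrtC_ge0 ?ler0n // -invfM -expr2 sqrtCK.
Qed.

(** The x-basis vectors are the eigenvectors of [sigma_x] for +1 and -1; [inord a] sends the outcome
    + to 0 and - to 1. *)
Lemma outcome_proj_x a : outcome_proj (sigma_x C) a =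
  xbasis C (inord a) *m (xbasis C (inord a))^t*.
Proof.
apply/matrixP => i j; rewrite !mxE big_ord1 !mxE inordK; last by case: a.
(* Splitting [2^-1] into the two normalization factors makes each entry a polynomial identity in
   them. *)
rewrite !rmorphM !rmorphD !rmorphM /= rmorph_sign -invr_sqrtC2_normsq.
by case: (ord2P i) => ->; case: (ord2P j) => ->; case: a;
  rewrite /= ?eqxx ?mulr1n ?mulr0n ?conjC0 ?conjC1; ring.
Qed.

Lemma outcome_proj_y a : outcome_proj (sigma_y C) a =
  ybasis C (inord a) *m (ybasis C (inord a))^t*.
Proof.
apply/matrixP => i j; rewrite !mxE big_ord1 !mxE inordK; last by case: a.
rewrite !rmorphM !rmorphD !rmorphM /= rmorph_sign conjCi
  -invr_sqrtC2_normsq.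
by case: (ord2P i) => ->; case: (ord2P j) => ->; case: a;
  rewrite /= ?eqxx ?mulr1n ?mulr0n ?conjC0 ?conjC1; ring: (sqrCi C).
Qed.

Definition postmeasurement (w : 'cV[C]_2) (rho : 'M[C]_(2 * 2)) : 'M[C]_2 :=
  ptrace1 (((w *m w^t*) *t 1%:M) *m rho).

Lemma psdmx_postmeasurement w rho : psdmx rho -> psdmx (postmeasurement w rho).
Proof. by move=> rho_ge0 v; rewrite /postmeasurement sesqform_ptrace1. Qed.

Lemma sesqform_scalar n (u v : 'cV[C]_n) : scalar (fun M => sesqform M u v).
Proof.
by move=> c M N; rewrite /sesqform mulmxDr mulmxDl -scalemxAr -scalemxAl !mxE.
Qed.

Lemma imag_coord_scalar e : scalar (imag_coord e).
Proof. by move=> c M N; rewrite /imag_coord !sesqform_scalar; ring. Qed.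

Lemma postmeasurement_linear w : linear (postmeasurement w).
Proof.
move=> c M N; rewrite /postmeasurement mulmxDr -scalemxAr.
apply/matrixP => k l; rewrite !mxE mulr_sumr -big_split /=.
by apply: eq_bigr => i _; rewrite !mxE.
Qed.

Lemma imag_coordZ e c M : imag_coord e (c *: M) = c * imag_coord e M.
Proof.
have e_lin := imag_coord_scalar e.
by rewrite -[c *: M]addr0 e_lin scalar_eq0 // addr0.
Qed.

(** The robustness is the modulus of a linear functional, so a probability [p > 0] moves inside the
    modulus and cancels the normalization [p^-1]. *)
Lemma outcome_robustness s a w e rho :
  outcome_proj s a = w *m w^t* -> psdmx rho ->
  outcome_prob s a rho * robustness_imaginarity e (conditional_state s a rho)
  = `|imag_coord e (postmeasurement w rho)|.
Proof.
move=> sE rho_ge0; rewrite robustness_imaginarityE /conditional_state.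
set p := outcome_prob s a rho; rewrite sE -/(postmeasurement w rho).
set M := postmeasurement w rho.
have M_ge0 : psdmx M by exact: psdmx_postmeasurement.
have pE : p = \tr M by rewrite mxtrace_ptrace1 /p /outcome_prob sE.
have p_ge0 : 0 <= p by rewrite pE sumr_ge0 // => i _; exact: psdmx_diag_ge0.
(* If p = 0, the entry bound forces the unnormalized state to vanish. *)
have [p0|p_neq0] := eqVneq p 0.
  rewrite p0 mul0r (_ : M = 0 *: M) ?imag_coordZ ?mul0r ?normr0 // scale0r.
  apply/matrixP => i j; rewrite [RHS]mxE; apply/eqP; rewrite -normr_le0.
  by rewrite (le_trans (psdmx_entry_le i j M_ge0)) // -pE p0 mulr0.
rewrite -[X in X * _]ger0_norm // -normrM -imag_coordZ.
by rewrite scalerA mulfV ?scale1r.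
Qed.

(** * The quantity I_2 as a sum of moduli, and convexity *)

Definition imag_after e w (rho : 'M[C]_(2 * 2)) : C :=
  imag_coord e (postmeasurement w rho).

Lemma imag_after_scalar e w : scalar (imag_after e w).
Proof.
by move=> c M N; rewrite /imag_after postmeasurement_linear imag_coord_scalar.
Qed.

(** A division-free form of [I2], equal to it on positive semidefinite matrices, and convex on the
    whole matrix space. *)
Definition I2_abs (rho : 'M[C]_(2 * 2)) : C :=
  \sum_(a : bool) `|imag_after (@xbasis C) (ybasis C (inord a)) rho| +
  \sum_(a : bool) `|imag_after (@ybasis C) (xbasis C (inord a)) rho|.

Lemma I2E rho : psdmx rho -> I2 rho = I2_abs rho.
Proof.
move=> rho_ge0; congr (_ + _); apply: eq_bigr => a _;
  apply: outcome_robustness => //.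
  exact: outcome_proj_y.
exact: outcome_proj_x.
Qed.

(** This splits the set into conditions that can be treated one at a time, both for convexity and
    for closedness. *)
Lemma I2_sublevelE : @I2_sublevel C =
  [set rho | forall v, 0 <= sesqform rho v v] `&` [set rho | \tr rho = 1]
    `&` [set rho | I2_abs rho <= sqrtC 2].
Proof.
apply/seteqP; split=> rho /=.
  by move=> [/density_matrixP[? ?]]; rewrite I2E.
by move=> [[? ?] ?]; split; [apply/density_matrixP | rewrite I2E].
Qed.

Lemma norm_scalar_conv (V : lmodType C) (f : V -> C) a b x y :
  scalar f -> 0 <= a -> 0 <= b ->
  `|f (a *: x + b *: y)| <= a * `|f x| + b * `|f y|.
Proof.
move=> f_lin a0 b0; rewrite scalar_comb // (le_trans (ler_normD _ _)) //.
by rewrite !normrM (ger0_norm a0) (ger0_norm b0).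
Qed.

Lemma I2_abs_conv a b x y : 0 <= a -> 0 <= b ->
  I2_abs (a *: x + b *: y) <= a * I2_abs x + b * I2_abs y.
Proof.
move=> a0 b0; rewrite /I2_abs !mulrDr addrACA !mulr_sumr -!big_split /=.
by apply: ler_sum => i _; apply: lerD; apply: norm_scalar_conv => //;
  exact: imag_after_scalar.
Qed.

Lemma I2_sublevel_convex : convex_set (@I2_sublevel C).
Proof.
move=> x y l; rewrite I2_sublevelE !inE => -[[x_ge0 trx] Ix] [[y_ge0 tr_y] Iy].
have l_ge0 : 0 <= l%:inum :> C by [].
have onem_l_ge0 : 0 <= 1 - l%:inum :> C by [].
have lE : l%:inum + (1 - l%:inum) = 1 :> C by rewrite addrC subrK.
rewrite (_ : conv l x y = l%:inum *: x + (1 - l%:inum) *: y) //.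
split; first split => /=.
- move=> v; rewrite (scalar_comb _ _ _ _ (sesqform_scalar v v)).
  by rewrite addr_ge0 // mulr_ge0.
- by rewrite mxtraceD !mxtraceZ trx tr_y !mulr1.
- apply: le_trans (I2_abs_conv _ _ _ _) _ => //.
  (* The bound is written as [l * sqrtC 2 + (1 - l) * sqrtC 2], to be compared term by term. *)
  rewrite -[leRHS]mul1r -[X in X * sqrtC _]lE [leRHS]mulrDl.
  by apply: lerD; apply: ler_wpM2l.
Qed.

End I2.

(** * Closed conditions and continuity of linear functionals *)

Lemma closed_le_continuous (K : numFieldType) (T : topologicalType)
    (f g : T -> K) :
  continuous f -> continuous g -> closed [set x | f x <= g x].
Proof.
move=> cf cg.
(* The order may be partial, but [0 <= y] holds exactly when [y] equals its norm. The inequality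
   thus becomes an equation between continuous functions. *)
have -> : [set x | f x <= g x] = [set x | `|g x - f x| - (g x - f x) = 0].
  apply/seteqP; split=> x /=.
    by move=> fg; rewrite ger0_norm ?subrr // subr_ge0.
  by move/eqP; rewrite subr_eq0 => /eqP h; rewrite -subr_ge0 -h normr_ge0.
have cgf : continuous (fun x => g x - f x).
  by move=> x; apply: cvgB; [exact: cg | exact: cf].
apply: (@preimage_closed _ _ (fun x => `|g x - f x| - (g x - f x)) [set 0]).
  move=> x _; apply: cvgB; last exact: cgf.
  by apply: (@cvg_norm _ K); exact: cgf.
exact/accessible_closed_set1/hausdorff_accessible/norm_hausdorff.
Qed.

Lemma continuous_sum (K : numFieldType) (T : topologicalType) (I : Type)
    (r : seq I) (F : I -> T -> K) :
  (forall i, continuous (F i)) -> continuous (fun x => \sum_(i <- r) F i x).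
Proof.
move=> F_cont; elim: r => [|i r IHr].
  rewrite (_ : (fun _ => _) = cst 0); first by move=> x; exact: cvg_cst.
  by apply/funext => x; rewrite big_nil.
rewrite (_ : (fun _ => _) = (fun x => F i x + \sum_(j <- r) F j x)).
  by move=> x; apply: cvgD; [exact: F_cont|exact: IHr].
by apply/funext => x; rewrite big_cons.
Qed.

(** In finite dimension a linear functional is a finite sum of matrix entries times its values on
    the [delta_mx i j]. *)
Lemma scalar_continuous (K : numFieldType) m n (f : 'M[K]_(m, n) -> K) :
  scalar f -> continuous f.
Proof.
move=> f_lin.
have fE M : f M = \sum_i \sum_j M i j * f (delta_mx i j).
  rewrite [in LHS](matrix_sum_delta M).
  elim/big_rec2 : _ => [|i _ N _ <-]; first exact: scalar_eq0.
  elim/big_rec2 : _ => [|j r N' _ IH]; first by rewrite !add0r.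
  by rewrite -!addrA f_lin IH addrA.
have entry_cont i j :
    continuous (fun M : 'M[K]_(m, n) => M i j * f (delta_mx i j)).
  move=> M; have M_cont := @coord_continuous K m n i j M.
  exact: (cvgM M_cont (cvg_cst _)).
rewrite (funext fE); apply: continuous_sum => i.
by apply: continuous_sum => j; exact: entry_cont.
Qed.

(** * Compact boxes of complex matrices *)

Lemma vec_mx_continuous (T : topologicalType) m n :
  continuous (@vec_mx T m n).
Proof.
move=> v A [P P_nbhs PA].
(* [ij] inverts [mxvec_index]: the entrywise neighborhoods [P i j] of the matrix are reindexed as
   neighborhoods of the coordinates of [v]. *)
pose ij k := enum_val (cast_ord (esym (mxvec_cast m n)) k).
have ijK i j : ij (mxvec_index i j) = (i, j).
  by rewrite /ij /mxvec_index cast_ordK enum_rankK.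
exists (fun _ k => P (ij k).1 (ij k).2) => [i k|w Pw] /=.
  rewrite ord1; case/mxvec_indexP: k => i' j'; rewrite ijK /=.
  by have := P_nbhs i' j'; rewrite mxE.
by apply: PA => i j; rewrite mxE; have := Pw 0 (mxvec_index i j); rewrite ijK.
Qed.

(** The set is the continuous image under [vec_mx] of a product of copies of [A] in the row vectors,
    which is compact by [rV_compact]. *)
Lemma compact_mx (T : ptopologicalType) m n (A : set T) :
  compact A -> compact [set M : 'M[T]_(m, n) | forall i j, A (M i j)].
Proof.
move=> A_compact.
have -> : [set M : 'M[T]_(m, n) | forall i j, A (M i j)] =
    vec_mx @` [set v : 'rV[T]_(m * n) | forall k, A (v ord0 k)].
  apply/seteqP; split=> [M AM|M [v Av <-] i j] /=; last first.
    by rewrite mxE; exact: Av.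
  exists (mxvec M); last exact: mxvecK.
  by move=> k; case/mxvec_indexP: k => i j; rewrite mxvecE.
apply: continuous_compact; last exact: (@rV_compact _ _ (fun=> A)).
exact/continuous_subspaceT/vec_mx_continuous.
Qed.

Lemma real_complex_continuous (R : realType) :
  continuous (fun x : R => (x%:C)%C : complex_numbers R).
Proof.
move=> x; apply/cvgrPdist_lt => e e_gt0.
(* A positive element of [R[i]] is real, so the estimate reduces to one in [R]. *)
have [d eE] : exists d : R, e = (d%:C)%C.
  by apply/complex_realP; exact: gtr0_real.
have d_gt0 : 0 < d by move: e_gt0; rewrite eE ltcR.
near=> y.
rewrite eE -rmorphB /= normc_def /= expr0n addr0 sqrtr_sqr ltcR.
near: y; exact: cvgr_dist_lt.
Unshelve. all: by end_near. Qed.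

(** A square rather than a disc: it is the continuous image of a product of two real segments. *)
Definition complex_box (R : realType) (r : R) : set (complex_numbers R) :=
  [set z | `|complex.Re z| <= r /\ `|complex.Im z| <= r].

Lemma compact_complex_box (R : realType) (r : R) : compact (complex_box r).
Proof.
pose f (p : R * R) : complex_numbers R :=
  ((p.1)%:C)%C + ('i)%C * ((p.2)%:C)%C.
have -> : complex_box r = f @` (`[- r, r]%classic `*` `[- r, r]%classic).
  apply/seteqP; split=> [[a b] /= [ar br]|z [[a b] /= [ar br] <-]].
    exists (a, b); last by rewrite /f [RHS]complexE.
    by rewrite /= !in_itv /= -!ler_norml.
  rewrite /f /complex_box /=; simpc; rewrite /= !ler_norml.
  by move: ar br; rewrite !in_itv.
apply: continuous_compact; last first.
  by apply: compact_setX; exact: segment_compact.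
apply: continuous_subspaceT => p; apply: cvgD; last apply: cvgM.
- apply: (@cvg_comp _ _ _ fst (fun x : R => (x%:C)%C : complex_numbers R)).
    exact: cvg_fst.
  exact: real_complex_continuous.
- exact: cvg_cst.
- apply: (@cvg_comp _ _ _ snd (fun x : R => (x%:C)%C : complex_numbers R)).
    exact: cvg_snd.
  exact: real_complex_continuous.
Qed.

(** * Closedness and compactness of the sublevel set *)

Lemma I2_sublevel_closed (C : numClosedFieldType) : closed (@I2_sublevel C).
Proof.
rewrite I2_sublevelE; apply: closedI; first apply: closedI.
(* Positivity is tested one vector at a time; for fixed [v] the form is linear in [rho], hence gives
   a closed condition. *)
- have -> : [set rho : 'M[C]_(2 * 2) | forall v, 0 <= sesqform rho v v] =
      \bigcap_(v in [set: 'cV[C]_(2 * 2)]) [set rho | 0 <= sesqform rho v v].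
    by apply/seteqP; split=> rho /= h v; [move=> _; exact: h|exact: (h v I)].
  apply: closed_bigI => v _.
  exact: (closed_le_continuous (@cst_continuous _ _ (0 : C))
    (scalar_continuous (sesqform_scalar v v))).
- apply: (@preimage_closed _ _ (fun rho : 'M[C]_(2 * 2) => \tr rho) [set 1]).
    move=> rho _; apply: scalar_continuous => c M N.
    by rewrite mxtraceD mxtraceZ.
  exact/accessible_closed_set1/hausdorff_accessible/norm_hausdorff.
- have abs_cont e w :
      continuous (fun rho : 'M[C]_(2 * 2) => `|imag_after e w rho|).
    move=> rho.
    have f_cont := @scalar_continuous _ _ _ _ (imag_after_scalar e w) rho.
    exact: (cvg_norm f_cont).
  have sum_cont e (w : bool -> 'cV[C]_2) : continuous
      (fun rho : 'M[C]_(2 * 2) => \sum_(a : bool) `|imag_after e (w a) rho|).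
    exact: (@continuous_sum _ _ _ _ (fun a rho => `|imag_after e (w a) rho|)
      (fun a => abs_cont e (w a))).
  have I2_cont : continuous (@I2_abs C).
    by move=> rho; exact: (cvgD (@sum_cont _ _ rho) (@sum_cont _ _ rho)).
  exact: (closed_le_continuous I2_cont (@cst_continuous _ _ _)).
Qed.

Lemma I2_sublevel_compact (R : realType) :
  compact (@I2_sublevel (complex_numbers R)).
Proof.
(* The radius 2 is the entry bound [2 * \tr rho] at trace 1. *)
have box_compact := @compact_mx _ (2 * 2) (2 * 2) _ (@compact_complex_box R 2).
apply: (subclosed_compact _ box_compact); first exact: I2_sublevel_closed.
move=> rho.
rewrite I2_sublevelE => -[[rho_ge0 tr_rho] _] i j /=.
have := psdmx_entry_le i j rho_ge0; rewrite tr_rho mulr1.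
case: (rho i j) => a b; rewrite normc_def (_ : 2 = (2 : R)%:C%C) ?lecR /=.
  (* The real and imaginary parts are each bounded by the modulus. *)
  move=> ab_le; split; apply: le_trans ab_le; rewrite -sqrtr_sqr ler_wsqrtr //.
    by rewrite lerDl sqr_ge0.
  by rewrite lerDr sqr_ge0.
by rewrite rmorph_nat.
Qed.

Theorem theorem3 (R : realType) :
  convex_set (@I2_sublevel (complex_numbers R)) /\
  compact (@I2_sublevel (complex_numbers R)).
Proof. by split; [exact: I2_sublevel_convex | exact: I2_sublevel_compact]. Qed.
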